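(* Let $S=\{\pm 2^m m! \mid m\in\mathbb{Z}_{\ge 0}\}\subset\mathbb{Z}$ and let $\|\cdot\|_S$ be the word norm on $\mathbb{Z}$ generated by $S$. Let $\omega$ be a non-principal ultrafilter on $\mathbb{N}$. Then the asymptotic cone $\mathrm{Cone}_\omega(\mathbb{Z},\|\cdot\|_S)$ contains non-trivial elements of order two. In particular, $\mathrm{Cone}_\omega(\mathbb{Z},\|\cdot\|_S)$ and $\mathbb{R}$ are not isomorphic as groups.
   Context: For a generating set $S$ of a group $G$, the word norm is $\|g\|_S=\min\{k\ge 0 \mid g=s_1\cdots s_k,\ s_i\in S\}$ (with the identity having norm $0$). It induces the metric $d(g,h)=\|gh^{-1}\|_S$ (here $G=\mathbb{Z}$ is written additively and $d(x,y)=\|x-y\|_S$). Asymptotic cone, with scaling sequence $s_n=n$: a sequence $(x_n)_{n\ge1}$ in $G$ is admissible if $\|x_n\|/n$ is bounded. $\mathrm{Cone}_\omega(G,\|\cdot\|)$ is the set of admissible sequences modulo $(x_n)\sim(y_n)$ iff $\lim_\omega d(x_n,y_n)/n=0$, where $\lim_\omega$ is the ultralimit along $\omega$. When the norm is conjugation invariant (as is automatic for abelian $G$), termwise multiplication makes it a group, with metric $d([x_n],[y_n])=\lim_\omega d(x_n,y_n)/n$. *)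

(* Defs.v *)
From HB Require Import structures.
From mathcomp Require Import all_boot all_order all_algebra.
From mathcomp Require Import all_classical all_reals.
From mathcomp Require Import topology normedtype.

Set Implicit Arguments.
Unset Strict Implicit.
Unset Printing Implicit Defensive.

Import Order.TTheory GRing.Theory Num.Theory.
Import numFieldTopology.Exports numFieldNormedType.Exports.

Local Open Scope classical_set_scope.
Local Open Scope ring_scope.

(* Groups are abelian and written additively, so conjugation invariance of a
   norm is automatic. *)
Record groupNorm (R : realType) (G : zmodType) := GroupNorm {
  grpnorm :> G -> R ;
  grpnorm_eq0 : forall g, grpnorm g = 0 <-> g = 0 ;
  grpnormN : forall g, grpnorm (- g) = grpnorm g ;
  grpnormD_le : forall g h, grpnorm (g + h) <= grpnorm g + grpnorm h
}.

Section WordNorm.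
Context {G : zmodType}.
Implicit Types (S : set G) (g h : G) (k : nat).

Definition is_word S g : pred nat := fun k =>
  `[< exists s : seq G,
        [/\ size s = k, {in s, forall x, S x} & g = \sum_(x <- s) x] >].

(* No formal inverses in words: for S = -S, this is generation as a group. *)
Definition generating S := forall g, exists k, is_word S g k.

Definition word_norm S (genS : generating S) g : nat := ex_minn (genS g).

Variables (S : set G) (genS : generating S) (symS : forall x, S x -> S (- x)).

Lemma word_norm_eq0 g : word_norm genS g = 0%N <-> g = 0.
Proof.
rewrite /word_norm; case: ex_minnP => k /asboolP[s [sk sS ->]] kmin.
split=> [k0|s0].
  by move: sk; rewrite k0 => /size0nil ->; rewrite big_nil.
apply/eqP; rewrite -leqn0; apply: kmin; apply/asboolP.
by exists [::]; split => //; rewrite big_nil s0.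
Qed.

Lemma word_normN_le g : (word_norm genS (- g) <= word_norm genS g)%N.
Proof.
rewrite /word_norm; case: ex_minnP => k _ kmin.
case: ex_minnP => l /asboolP[s [sl sS gE]] _; apply: kmin; apply/asboolP.
exists [seq - x | x <- s]; split; first by rewrite size_map.
- by move=> _ /mapP[x xs ->]; apply/symS/sS.
- by rewrite gE big_map sumrN.
Qed.

Lemma word_normN g : word_norm genS (- g) = word_norm genS g.
Proof.
apply/eqP; rewrite eqn_leq word_normN_le /=.
by rewrite -{1}(opprK g) word_normN_le.
Qed.

Lemma word_normD_le g h :
  (word_norm genS (g + h) <= word_norm genS g + word_norm genS h)%N.
Proof.
rewrite /word_norm; case: ex_minnP => k _ kmin.
case: ex_minnP => l /asboolP[s [sl sS gE]] _.
case: ex_minnP => m /asboolP[t [tm tS hE]] _.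
apply: kmin; apply/asboolP; exists (s ++ t); split.
- by rewrite size_cat sl tm.
- by move=> x; rewrite mem_cat => /orP[/sS|/tS].
- by rewrite gE hE big_cat.
Qed.

Variable R : realType.

Let word_normR g : R := (word_norm genS g)%:R.

Fact word_normR_eq0 g : word_normR g = 0 <-> g = 0.
Proof.
rewrite -(word_norm_eq0 g) /word_normR; split=> [/eqP|->//].
by rewrite pnatr_eq0 => /eqP.
Qed.

Fact word_normRN g : word_normR (- g) = word_normR g.
Proof. by rewrite /word_normR word_normN. Qed.

Fact word_normRD_le g h : word_normR (g + h) <= word_normR g + word_normR h.
Proof. by rewrite /word_normR -natrD ler_nat word_normD_le. Qed.

Definition word_groupNorm : groupNorm R G :=
  GroupNorm word_normR_eq0 word_normRN word_normRD_le.

End WordNorm.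

Section Cone.
Context {R : realType} {G : zmodType} (N : groupNorm R G).

Lemma grpnorm0 : N 0 = 0. Proof. exact/grpnorm_eq0. Qed.

Lemma grpnorm_ge0 g : 0 <= N g.
Proof.
have := grpnormD_le N g (- g).
by rewrite subrr grpnorm0 grpnormN -mulr2n pmulrn_lge0.
Qed.

(* Sequences are indexed by n >= 1; the term at n = 0 is a dummy, which is
   irrelevant for a non-principal ultrafilter. *)
Definition admissible : pred (nat -> G) := fun x =>
  `[< exists C : R, forall n, (0 < n)%N -> N (x n) / n%:R <= C >].

Fact admissible_zmod_closed : zmod_closed admissible.
Proof.
split.
  by apply/asboolP; exists 0 => n _; rewrite grpnorm0 mul0r.
move=> x y /asboolP[C xC] /asboolP[D yD]; apply/asboolP; exists (C + D) => n n0.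
apply: le_trans (lerD (xC n n0) (yD n n0)); rewrite -mulrDl.
by rewrite ler_wpM2r ?invr_ge0// -(grpnormN N (y n)) grpnormD_le.
Qed.

HB.instance Definition _ :=
  GRing.isZmodClosed.Build (nat -> G) admissible admissible_zmod_closed.

Record admSeq := AdmSeq {
  admSeq_val :> nat -> G ;
  _ : admSeq_val \in admissible
}.

HB.instance Definition _ := [isSub for admSeq_val].
HB.instance Definition _ := [Choice of admSeq by <:].
HB.instance Definition _ := [SubChoice_isSubZmodule of admSeq by <:].

Section Quotient.
Variables (omega : set_system nat) (Uomega : UltraFilter omega).

Definition null_seq : pred admSeq := fun x =>
  `[< N (x n) / n%:R @[n --> omega] --> (0 : R) >].

Fact null_seq_zmod_closed : zmod_closed null_seq.
Proof.
split.
  apply/asboolP; rewrite (_ : (fun n => _) = cst 0); first exact: cvg_cst.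
  by apply/funext => n /=; rewrite grpnorm0 mul0r.
move=> x y /asboolP x0 /asboolP y0; apply/asboolP.
have xy0 : N (x n) / n%:R + N (y n) / n%:R @[n --> omega] --> (0 : R).
  by rewrite -[X in _ --> X](addr0 (0 : R)); apply: cvgD.
apply: (squeeze_cvgr _ (cvg_cst (0 : R)) xy0); apply: nearW => n.
apply/andP; split; first by rewrite divr_ge0 ?grpnorm_ge0.
rewrite -mulrDl.
by rewrite ler_wpM2r ?invr_ge0// -(grpnormN N (y n)) grpnormD_le.
Qed.

Definition null_seq_zmodClosed : zmodClosed admSeq :=
  HB.pack null_seq (GRing.isZmodClosed.Build admSeq null_seq
                      null_seq_zmod_closed).

(* x ~ y iff x - y is a null sequence, that is, iff d(x_n, y_n) / n tends to 0
   along omega, where d(g, h) = N (g - h). *)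
Definition cone := Quotient.quot null_seq_zmodClosed.

HB.instance Definition _ := ZmodQuotient.on cone.

Lemma cone_eqP (x y : admSeq) :
  \pi_cone%qT x = \pi_cone%qT y :> cone <->
  N (x n - y n) / n%:R @[n --> omega] --> (0 : R).
Proof.
rewrite (rwP eqP) -[_ == _]Quotient.idealrBE.
by split=> [/asboolP|h]; last exact/asboolP.
Qed.

End Quotient.
End Cone.

Definition fact_gens : set int :=
  [set x | exists m : nat, x = (2 ^ m * m`!)%N%:Z \/ x = - (2 ^ m * m`!)%N%:Z].

Lemma fact_gensN x : fact_gens x -> fact_gens (- x).
Proof.
by case=> m [] ->; exists m; [right | left]; rewrite ?opprK.
Qed.

Lemma fact_gens_generating : generating fact_gens.
Proof.
move=> g; exists `|g|%N; apply/asboolP.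
exists (nseq `|g|%N (if 0 <= g then 1 else -1)); split.
- by rewrite size_nseq.
- move=> x; rewrite mem_nseq => /andP[_ /eqP ->]; exists 0%N.
  by case: ifP => _; [left | right].
- rewrite big_nseq iter_addr_0; case: g => n /=; first by rewrite natz.
  by rewrite NegzE mulNrn natz.
Qed.

Definition fact_norm (R : realType) : groupNorm R int :=
  word_groupNorm fact_gens_generating fact_gensN R.

(* Main.v *)
Require Import Defs.
From HB Require Import structures.
From mathcomp Require Import all_boot all_order all_algebra.
From mathcomp Require Import all_classical all_reals.
From mathcomp Require Import topology normedtype.
From mathcomp Require Import zify.

Import Order.TTheory GRing.Theory Num.Theory.
Import numFieldTopology.Exports numFieldNormedType.Exports.
Local Open Scope ring_scope.

(** Put [a_n = 2^n n!], so that [a_n = 2n a_(n-1)], and let [x_n = a_n / 2 = n a_(n-1)].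
    The class of [x_n] has order two: [2 x_n = a_n] has norm at most 1, while
    [x_n] has norm at least [n]. Indeed, a generator is either a multiple of
    [a_n] or bounded by [a_(n-1)], so modulo [a_n] a sum of fewer than [n]
    generators is smaller than [n a_(n-1) = a_n / 2] in absolute value. *)

Definition dfact (n : nat) : nat := (2 ^ n * n`!)%N.

Lemma dfactS n : dfact n.+1 = (2 * (n.+1 * dfact n))%N.
Proof. by rewrite /dfact expnS factS; lia. Qed.

Lemma dfact_gt0 n : (0 < dfact n)%N.
Proof. by rewrite muln_gt0 expn_gt0 fact_gt0. Qed.

Lemma leq_dfact {m n} : (m <= n)%N -> (dfact m <= dfact n)%N.
Proof. by move=> mn; rewrite leq_mul ?leq_pexp2l ?leq_fact. Qed.

Lemma dvdn_dfact {m n} : (m <= n)%N -> (dfact m %| dfact n)%N.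
Proof. by move=> mn; rewrite dvdn_mul ?dvdn_exp2l// (fact_split mn) dvdn_mulr. Qed.

(** This is [x_n], written without a division; at [n = 0] the value is 0, which is not half of
    [dfact 0 = 1]. *)
Definition half_dfact (n : nat) : int := (n * dfact n.-1)%N%:Z.

(** For [m <= n] the generator is its own remainder; for [m > n] it is a multiple of [dfact n.+1]
    and the remainder is 0. *)
Lemma fact_gens_split n {x : int} : fact_gens x ->
  exists q r : int, x = q * (dfact n.+1)%:Z + r /\ `|r| <= (dfact n)%:Z.
Proof.
case=> m xE; have [mn|nm] := leqP m n.
  by exists 0, x; have := leq_dfact mn; move: xE; rewrite -/(dfact m); lia.
have /dvdnP[q qE] := dvdn_dfact nm.
have xE' : x = q%:Z * (dfact n.+1)%:Z \/ x = - q%:Z * (dfact n.+1)%:Z.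
  by rewrite mulNr -PoszM -qE.
by case: xE' => ->; [exists q%:Z, 0 | exists (- q%:Z), 0]; rewrite addr0 normr0.
Qed.

Lemma sum_fact_gens_split n {s : seq int} : {in s, forall x, fact_gens x} ->
  exists q r : int, \sum_(x <- s) x = q * (dfact n.+1)%:Z + r /\
    `|r| <= (size s * dfact n)%N%:Z.
Proof.
elim: s => [_|x s IHs sS]; first by exists 0, 0; rewrite big_nil mul0r.
have [|q [r [sE rle]]] := IHs; first by move=> y ys; apply: sS; rewrite inE ys orbT.
have [|q' [r' [xE r'le]]] := fact_gens_split n (x := x); first by apply: sS; rewrite mem_head.
exists (q' + q), (r' + r); rewrite big_cons sE xE mulrDl addrACA; split=> //.
by rewrite /= mulSn PoszD (le_trans (ler_normD _ _)) ?lerD.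
Qed.

Lemma word_norm_le {G : zmodType} {S : set G} (genS : generating S) {s : seq G} :
  {in s, forall x, S x} -> (word_norm genS (\sum_(x <- s) x) <= size s)%N.
Proof.
move=> sS; rewrite /word_norm; case: ex_minnP => k _; apply.
by apply/asboolP; exists s.
Qed.

Lemma word_norm_half_dfact_ge n :
  (n <= word_norm fact_gens_generating (half_dfact n))%N.
Proof.
case: n => // n; rewrite /word_norm; case: ex_minnP => k /asboolP[s [<- sS hE]] _.
have [q [r [sE rle]]] := sum_fact_gens_split n sS.
rewrite leqNgt; apply/negP => sn.
have rlt : `|r| < half_dfact n.+1.
  by rewrite (le_lt_trans rle)// ltz_nat ltn_mul2r dfact_gt0.
(* As [dfact n.+1] is twice [half_dfact n.+1], the remainder is an odd multiple of
   [half_dfact n.+1]. An odd factor has absolute value at least 1, which contradicts [rlt]. *)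
have : r = (1 - 2 * q) * half_dfact n.+1.
  by move: sE; rewrite -hE dfactS /half_dfact /=; lia.
move=> rE; move: rlt; rewrite rE normrM [ `|half_dfact _|]ger0_norm//.
rewrite ltNge => /negP; apply; rewrite ler_peMl//; lia.
Qed.

(** The word consists of [n] copies of the generator [dfact n.-1]. This bound makes the sequence
    admissible. *)
Lemma word_norm_half_dfact_le n :
  (word_norm fact_gens_generating (half_dfact n) <= n)%N.
Proof.
have -> : half_dfact n = \sum_(x <- nseq n (dfact n.-1)%:Z) x.
  by rewrite big_nseq iter_addr_0 -mulr_natl natz.
rewrite -[leqRHS](size_nseq n (dfact n.-1)%:Z); apply: word_norm_le => x.
by rewrite mem_nseq => /andP[_ /eqP->]; exists n.-1; left.
Qed.

Lemma word_norm_half_dfactM2_le n :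
  (word_norm fact_gens_generating (half_dfact n + half_dfact n) <= 1)%N.
Proof.
case: n => [|n].
  (* Here the double is 0 rather than a generator, so the empty word is used. *)
  have -> : half_dfact 0 + half_dfact 0 = \sum_(x <- [::]) x by rewrite big_nil.
  exact: leq_trans (word_norm_le _ _) _.
have -> : half_dfact n.+1 + half_dfact n.+1 = \sum_(x <- [:: (dfact n.+1)%:Z]) x.
  by rewrite big_seq1 dfactS /half_dfact /=; lia.
by apply: word_norm_le => x; rewrite inE => /eqP->; exists n.+1; left.
Qed.

(** An ultrafilter without singletons contains their complements, and finite intersections of these
    give every tail. *)
Lemma nonprincipal_ultra_cvg_infty {omega : set_system nat} :
    UltraFilter omega -> (forall n : nat, omega <> principal_filter n) ->
  (omega --> \oo)%classic.
Proof.
move=> Uomega npr.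
have nsing n : omega (~` [set n])%classic.
  have [on|//] := in_ultra_setVsetC [set n]%classic Uomega.
  (* If [[set n]] belongs to [omega], every member of [omega] meets it, so the members are exactly
     the sets containing [n]. *)
  exfalso; apply: (npr n); apply/seteqP; split=> A.
    move=> oA; apply/principal_filterP.
    by have [m [Am <-]] := filter_ex (filterI oA on).
  by move=> /principal_filterP An; apply: filterS on => _ ->.
  have tail N : omega [set n | (N <= n)%N]%classic.
  elim: N => [|N IHN]; first exact: filterS filterT.
  apply: filterS (filterI IHN (nsing N)) => n [/= Nn nN].
  by rewrite ltn_neqAle Nn andbT eq_sym; apply/eqP.
by move=> A [N _ NA]; apply: filterS (tail N).
Qed.

Lemma half_dfact_admissible (R : realType) :
  half_dfact \in admissible (fact_norm R).
Proof.
apply/asboolP; exists 1 => n n0.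
by rewrite ler_pdivrMr ?ltr0n// mul1r ler_nat word_norm_half_dfact_le.
Qed.

Definition half_dfact_seq (R : realType) : admSeq (fact_norm R) :=
  AdmSeq (half_dfact_admissible R).

Theorem proposition2p34 (R : realType) (omega : set_system nat)
    (Uomega : UltraFilter omega)
    (omega_nonprincipal : forall n : nat, omega <> principal_filter n) :
  (exists x : cone (fact_norm R) Uomega, x != 0 /\ x *+ 2 = 0) /\
  ~ (exists f : {additive cone (fact_norm R) Uomega -> R}, bijective f).
Proof.
have oinfty := nonprincipal_ultra_cvg_infty Uomega omega_nonprincipal.
have [x [x0 x2]] : exists x : cone (fact_norm R) Uomega, x != 0 /\ x *+ 2 = 0.
  pose h := half_dfact_seq R.
  exists (\pi_(cone (fact_norm R) Uomega)%qT h); split.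
    apply/eqP; rewrite -(raddf0 \pi_(cone (fact_norm R) Uomega)%qT).
    (* A zero class would force norm below [n] for some [n >= 1], against the lower bound. *)
    move=> /cone_eqP /cvgr_lt /(_ 1 ltr01) lt1.
    have ge1 : omega [set n | (1 <= n)%N]%classic by apply: oinfty; exists 1%N.
    have [n [/= nlt n1]] := filter_ex (filterI lt1 ge1).
    move: nlt; rewrite subr0 ltr_pdivrMr ?ltr0n// mul1r ltr_nat.
    by rewrite ltnNge word_norm_half_dfact_ge.
  rewrite -raddfMn -(raddf0 \pi_(cone (fact_norm R) Uomega)%qT).
  apply/cone_eqP.
  (* The doubled sequence has norm at most 1, so its scaled norm lies between 0 and [1/n]. *)
  have inv0 : ((n%:R^-1 : R) @[n --> omega] --> (0 : R))%classic.
    apply/gtr0_cvgV0; last exact: cvg_trans (cvg_app _ oinfty) cvgr_idn.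
    by apply: oinfty; exists 1%N => // n; rewrite /= ltr0n.
  apply: (squeeze_cvgr _ (cvg_cst (0 : R)) inv0); apply: nearW => n.
  apply/andP; split; first by rewrite divr_ge0 ?grpnorm_ge0.
  rewrite ler_piMl ?invr_ge0// subr0.
  by rewrite -[leRHS]/(1%:R) ler_nat word_norm_half_dfactM2_le.
split; first by exists x.
(* An injective additive map would send [x] to a nonzero element of order two, but [R] has no
   2-torsion. *)
move=> [f /bij_inj f_inj]; move/eqP: x0; apply; apply: f_inj; rewrite raddf0.
have /eqP : f x *+ 2 = 0 by rewrite -raddfMn x2 raddf0.
by rewrite mulrn_eq0 => /eqP.
Qed.
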